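(* The diagram of constructions $Dend_\infty[1]\rightsquigarrow pre\text{-}Lie_\infty[1]\rightsquigarrow L_\infty[1]$ and $Dend_\infty[1]\rightsquigarrow A_\infty[1]\rightsquigarrow L_\infty[1]$ commutes. That is, for any $Dend_\infty[1]$-algebra $(D,\{\mu_{k,[r]}\}_{k\ge1,[r]\in C_k})$ over a field of characteristic $0$, the $L_\infty[1]$-algebra on $D$ obtained by symmetrizing the associated $A_\infty[1]$-algebra $(D,\{\mu_k\}_{k\ge1})$ coincides with the subadjacent $L_\infty[1]$-algebra of the associated $pre\text{-}Lie_\infty[1]$-algebra $(D,\{\theta_k\}_{k\ge1})$.
   Context: Let $C_k=\{[1],\ldots,[k]\}$. A $Dend_\infty[1]$-algebra is a graded vector space $D$ with degree $1$ maps $\mu_{k,[r]}:D^{\otimes k}\to D$ for $k\ge1$, $[r]\in C_k$, such that for every $n\ge1$, $[r]\in C_n$ and homogeneous $a_1,\ldots,a_n\in D$, $\sum_{k+l=n+1}\sum_{i=1}^k(-1)^{|a_1|+\cdots+|a_{i-1}|}\mu_{k,R_0[r]}(a_1,\ldots,a_{i-1},\mu_{l,R_i[r]}(a_i,\ldots,a_{i+l-1}),a_{i+l},\ldots,a_n)=0$, where: if $1\le r\le i-1$, $R_0[r]=[r]$, $R_i[r]=[1]+\cdots+[l]$; if $i\le r\le i+l-1$, $R_0[r]=[i]$, $R_i[r]=[r-i+1]$; if $i+l\le r\le k+l-1$, $R_0[r]=[r-l+1]$, $R_i[r]=[1]+\cdots+[l]$; and $\mu_{l,[1]+\cdots+[l]}=\mu_{l,[1]}+\cdots+\mu_{l,[l]}$.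 The constructions ($\epsilon(\sigma)$ is the Koszul sign): - $Dend_\infty[1]\rightsquigarrow A_\infty[1]$: $\mu_k=\mu_{k,[1]}+\cdots+\mu_{k,[k]}$. - $A_\infty[1]\rightsquigarrow L_\infty[1]$: $l_k(a_1,\ldots,a_k)=\sum_{\sigma\in S_k}\epsilon(\sigma)\mu_k(a_{\sigma(1)},\ldots,a_{\sigma(k)})$. - $Dend_\infty[1]\rightsquigarrow pre\text{-}Lie_\infty[1]$: $\theta_k(a_1,\ldots,a_k)=\sum_{\sigma\in S_k}\epsilon(\sigma)\mu_{k,[\sigma^{-1}(k)]}(a_{\sigma(1)},\ldots,a_{\sigma(k)})$. - $pre\text{-}Lie_\infty[1]\rightsquigarrow L_\infty[1]$ (subadjacent): $l'_k(x_1,\ldots,x_k)=\sum_{i=1}^k(-1)^{|x_i|(|x_{i+1}|+\cdots+|x_k|)}\theta_k(x_1,\ldots,\widehat{x_i},\ldots,x_k,x_i)$. Each of these is known to produce a structure of the stated type; two $L_\infty[1]$-algebra structures on $D$ coincide if all their structure maps agree, i.e. $l_k=l'_k$ for all $k\ge1$. *)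

(* Defs.v *)
From mathcomp Require Import all_boot all_order all_algebra all_fingroup.
From mathcomp Require Import boolp classical_sets cardinality fsbigop.

Set Implicit Arguments.
Unset Strict Implicit.
Unset Printing Implicit Defensive.

Import GRing.Theory.
Local Open Scope ring_scope.

(* A Z-grading V = \bigoplus_n V_n, given by the projections V -> V_n: each
   vector is the sum of its finitely many nonzero components. *)
Record grading (K : fieldType) (V : lmodType K) := Grading {
  gcomp :> int -> {linear V -> V};
  gcomp_gcomp : forall m n v,
    gcomp m (gcomp n v) = if m == n then gcomp n v else 0;
  gcomp_finite : forall v, finite_set [set n | gcomp n v <> 0]%classic;
  gcomp_sum : forall v, v = \sum_(n \in [set: int]%classic) gcomp n v
}.

Section Operations.
Variables (K : fieldType) (V : lmodType K) (G : grading V).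

Definition homog (n : int) (v : V) : Prop := G n v = v.

Definition homogs k (d : k.-tuple int) (a : k.-tuple V) : Prop :=
  forall i, homog (tnth d i) (tnth a i).

Definition multilinear k (f : k.-tuple V -> V) : Prop :=
  forall (a : k.-tuple V) (i : 'I_k),
    linear (fun x : V => f [tuple if j == i then x else tnth a j | j < k]).

Definition degree1 k (f : k.-tuple V -> V) : Prop :=
  forall d a, homogs d a -> homog ((\sum_(i < k) tnth d i) + 1) (f a).

(* Arities are >= 1 and indices start at 0: for m : ops, m k is the operation
   on V^{\otimes (k+1)}, and for m : colored_ops, m k r is \mu_{k+1,[r+1]}. *)
Definition ops := forall k, k.+1.-tuple V -> V.
Definition colored_ops := forall k, 'I_k.+1 -> k.+1.-tuple V -> V.

Definition color_sum (mu : colored_ops) : ops :=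
  fun k a => \sum_(r < k.+1) mu k r a.

(* The colour R_0[r], and the operation \mu_{l,R_i[r]}, for an inner operation
   of arity l.+1 inserted at position i, hence occupying positions i to i + l. *)
Definition outer_color (l i r : nat) : nat :=
  if (r < i)%N then r else if (r <= i + l)%N then i else (r - l)%N.

Definition inner_op (mu : colored_ops) (l i r : nat) : l.+1.-tuple V -> V :=
  if (i <= r <= i + l)%N then mu l (inord (r - i)) else color_sum mu (k := l).

(* The inputs a_1, .., a_{i-1}, x, a_{i+l}, .., a_n of the outer operation;
   here l.+1 and k.+1 are the inner and outer arities. *)
Definition outer_args (k l i : nat) (a : seq V) (x : V) : k.+1.-tuple V :=
  [tuple if (j < i)%N then a`_j else if j == i :> nat then x else a`_(j + l)
   | j < k.+1].

Definition inner_args (l i : nat) (a : seq V) : l.+1.-tuple V :=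
  [tuple a`_(i + j) | j < l.+1].

(* n.+1 = k + l.+1 - 1 for the outer arity k := (n - l).+1. *)
Definition dend_relation (mu : colored_ops) : Prop :=
  forall n (r : 'I_n.+1) (d : n.+1.-tuple int) (a : n.+1.-tuple V),
    homogs d a ->
    \sum_(l < n.+1) \sum_(i < (n - l).+1)
      (-1 : K) ^ (\sum_(j < n.+1 | (j < i)%N) tnth d j) *:
      mu (n - l)%N (inord (outer_color l i r))
        (outer_args (n - l) l i a (inner_op mu i r (inner_args l i a)))
    = 0.

Record Dend_infty := DendInfty {
  dend_mu :> colored_ops;
  dend_multilinear : forall k (r : 'I_k.+1), multilinear (dend_mu r);
  dend_degree1 : forall k (r : 'I_k.+1), degree1 (dend_mu r);
  dend_rel : dend_relation dend_mu
}.

(* Linear extension of a formula f d a, given for a homogeneous of degrees d,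
   to all of V^{\otimes k}. *)
Definition linear_ext k (f : k.-tuple int -> k.-tuple V -> V) (a : k.-tuple V)
    : V :=
  \sum_(d \in [set: k.-tuple int]%classic)
    f d [tuple G (tnth d i) (tnth a i) | i < k].

Lemma linear_ext_homog k (f : k.-tuple int -> k.-tuple V -> V) d a :
  (forall d' b i, tnth b i = 0 -> f d' b = 0) ->
  homogs d a -> linear_ext f a = f d a.
Proof.
move=> f0 ha; rewrite /linear_ext -(fsbig_widen [set d]%classic) //.
  rewrite fsbig_set1; congr f; apply: eq_from_tnth => i.
  by rewrite tnth_mktuple ha.
move=> d' [_ /= /eqP nd]; have /existsP[i ni] : [exists i, tnth d' i != tnth d i].
  rewrite -negb_forall; apply: contra nd => /forallP e.
  by apply/eqP/eq_from_tnth => i; apply/eqP.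
by apply: (f0 _ _ i); rewrite tnth_mktuple -[tnth a i]ha gcomp_gcomp (negPf ni).
Qed.

Definition permute k (s : 'S_k) (a : k.-tuple V) : k.-tuple V :=
  [tuple tnth a (s i) | i < k].

Definition koszul_sign k (s : 'S_k) (d : k.-tuple int) : K :=
  \prod_(i < k) \prod_(j < k | (i < j)%N && (s j < s i)%N)
    (-1) ^ (tnth d (s i) * tnth d (s j)).

Definition symmetrization (m : ops) : ops := fun k =>
  linear_ext (fun d a => \sum_(s : 'S_k.+1)
    koszul_sign s d *: m k (permute s a)).

Definition preLie_of (mu : colored_ops) : ops := fun k =>
  linear_ext (fun d a => \sum_(s : 'S_k.+1)
    koszul_sign s d *: mu k (s^-1%g ord_max) (permute s a)).

(* x_1, .., x_{i-1}, x_{i+1}, .., x_k, x_i *)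
Definition move_last k (i : 'I_k.+1) (x : k.+1.-tuple V) : k.+1.-tuple V :=
  [tuple of rcons [tuple tnth x (lift i j) | j < k] (tnth x i)].

Definition subadjacent (theta : ops) : ops := fun k =>
  linear_ext (fun d x => \sum_(i < k.+1)
    (-1 : K) ^ (tnth d i * \sum_(j < k.+1 | (i < j)%N) tnth d j) *:
    theta k (move_last i x)).

End Operations.

(* Main.v *)
Require Import Defs.
From mathcomp Require Import all_boot all_order all_algebra.
From mathcomp Require Import all_fingroup.
From mathcomp Require Import fsbigop.

(** A permutation [s] in the symmetrized sum, together with a colour [r], is the
    same as a choice of the input [i = s r] that sits at the coloured position,
    followed by a permutation of the sequence in which [x_i] has been moved to
    the end. The signs agree because the Koszul sign is a cocycle, and the Koszul
    sign of moving [x_i] to the end is the sign of the subadjacent structure. *)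

Set Implicit Arguments.
Unset Strict Implicit.
Unset Printing Implicit Defensive.

Import GRing.Theory.
Local Open Scope ring_scope.

(** Both products run over unordered pairs, which [s] permutes; symmetry of [F] makes the order
    inside a pair irrelevant. *)
Lemma prod_lt_perm (R : comPzSemiRingType) n (s : 'S_n) (F : 'I_n -> 'I_n -> R) :
  (forall p q, F p q = F q p) ->
  \prod_(p < n) \prod_(q < n | (p < q)%N) F p q =
  \prod_(p < n) \prod_(q < n | (p < q)%N) F (s p) (s q).
Proof.
move=> Fsym; rewrite (reindex_inj (@perm_inj _ s)) /=.
under eq_bigr => i _ do rewrite (reindex_inj (@perm_inj _ s)) /=.
(* Pairs that [s] reverses are split off; swapping [i] and [j] in that factor restores [i < j]. *)
transitivity (\prod_(i < n) \prod_(j < n | (i < j)%N && (s i < s j)%N) F (s i) (s j) *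
              \prod_(i < n) \prod_(j < n | (j < i)%N && (s i < s j)%N) F (s i) (s j)).
  rewrite -big_split; apply: eq_bigr => i _ /=.
  rewrite (bigID (fun j : 'I_n => (i < j)%N)) /=; congr (_ * _).
    by apply: eq_bigl => j; rewrite andbC.
  apply: eq_bigl => j; rewrite -leqNgt [(j <= _)%N]leq_eqVlt andbC.
  by case: eqP => [/ord_inj->|//]; rewrite !ltnn.
rewrite [X in _ * X](exchange_big_dep xpredT) //= -big_split; apply: eq_bigr => i _ /=.
rewrite [RHS](bigID (fun j : 'I_n => (s i < s j)%N)) /=; congr (_ * _).
apply: eq_big => [j|j _]; last exact: Fsym.
rewrite -leqNgt [(s j <= _)%N]leq_eqVlt.
by case: eqP => [/ord_inj/perm_inj->|//]; rewrite !ltnn.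
Qed.

Section Koszul.
Variable K : fieldType.

Lemma signz_mul_self (m : int) : (-1 : K) ^ m * (-1) ^ m = 1.
Proof. by rewrite -expfzMl mulrNN mulr1 exp1rz. Qed.

Lemma koszul_signE n (s : 'S_n) (d : n.-tuple int) :
  koszul_sign K s d = \prod_(i < n) \prod_(j < n | (i < j)%N)
    (if (s j < s i)%N then (-1) ^ (tnth d (s i) * tnth d (s j)) else 1).
Proof. by apply: eq_bigr => i _; rewrite big_mkcondr. Qed.

(** The product [s * c] applies [s] first. It inverts a pair exactly when either [s] inverts the
    pair or [c] inverts its image, but not both; if both do, the same sign occurs twice and
    cancels. *)
Lemma koszul_signM n (s c : 'S_n) (d : n.-tuple int) :
  koszul_sign K (s * c)%g d =
  koszul_sign K s [tuple tnth d (c j) | j < n] * koszul_sign K c d.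
Proof.
(* The sign that [c] contributes at [p], [q]; inversion is phrased as a disagreement of two orders
   so that [F] is symmetric and can be transported along [s]. *)
pose F (p q : 'I_n) : K := if (p < q)%N != (c p < c q)%N
  then (-1) ^ (tnth d (c p) * tnth d (c q)) else 1.
have ltF (p q : 'I_n) : p != q -> (q < p)%N = ~~ (p < q)%N.
  by rewrite -leqNgt [(q <= p)%N]leq_eqVlt eq_sym => /negPf; rewrite -val_eqE => ->.
have Fsym (p q : 'I_n) : F p q = F q p.
  rewrite /F; have [->//|npq] := eqVneq p q.
  rewrite (ltF p q) // (ltF (c p) (c q)) ?(inj_eq perm_inj) //.
  by rewrite mulrC; do 2!case: (_ < _)%N.
have -> : koszul_sign K c d =
    \prod_(p < n) \prod_(q < n | (p < q)%N) F p q.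
  rewrite koszul_signE; apply: eq_bigr => p _; apply: eq_bigr => q pq.
  rewrite /F pq (ltF (c p) (c q)) ?(inj_eq perm_inj).
    by case: (_ < _)%N.
  by rewrite -val_eqE neq_ltn pq.
rewrite (prod_lt_perm s Fsym) !koszul_signE -big_split; apply: eq_bigr => i _.
rewrite -big_split; apply: eq_bigr => j ij /=.
have nij : i != j by rewrite -val_eqE neq_ltn ij.
rewrite /F !permM !tnth_mktuple (ltF (s i) (s j)) ?(inj_eq perm_inj) //.
rewrite (ltF (c (s i)) (c (s j))) ?(inj_eq perm_inj) //.
by do 2!case: (_ < _)%N => /=; rewrite ?mulr1 ?mul1r ?signz_mul_self.
Qed.

(** The only inversions pair the last position, which carries [i], with a position carrying some
    [j > i]. *)
Lemma koszul_sign_move_last k (i : 'I_k.+1) (d : k.+1.-tuple int) :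
  koszul_sign K (lift_perm ord_max i 1) d =
  (-1) ^ (tnth d i * \sum_(j < k.+1 | (i < j)%N) tnth d j).
Proof.
have -> : (-1 : K) ^ (tnth d i * \sum_(j < k.+1 | (i < j)%N) tnth d j) =
          \prod_(j < k.+1 | (i < j)%N) (-1) ^ (tnth d i * tnth d j).
  rewrite mulr_sumr; apply: (big_morph (fun m : int => (-1 : K) ^ m)) => // x y.
  by rewrite expfzDr // oppr_eq0 oner_eq0.
rewrite koszul_signE big_ord_recr /= [X in _ * X]big1 ?mulr1; last first.
  by move=> j; rewrite ltnNge -ltnS ltn_ord.
rewrite [RHS]big_mkcond [RHS](bigD1_ord i) //= ltnn mul1r.
apply: eq_bigr => p _; rewrite big_mkcond (bigD1_ord ord_max) //=.
have -> : widen_ord (leqnSn k) p = lift ord_max p.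
  by apply: val_inj; exact: esym (lift_max p).
rewrite !lift_perm_lift perm1 lift_perm_id ltn_ord.
rewrite big1 ?mulr1 => [|q _]; first by rewrite mulrC.
(* Two positions other than the last keep their order, since [lift i] is increasing. *)
rewrite !lift_perm_lift !perm1; case: ifP => // pq; case: ifP => //.
by rewrite /= ltnNge leq_bump2 ltnW //; move: pq;
   rewrite /bump [(k <= _)%N]leqNgt ltn_ord.
Qed.

End Koszul.

Section Symmetrization.
Variables (K : fieldType) (V : lmodType K) (G : grading V).

(** [linear_ext] evaluates its formula only on homogeneous components. *)
Lemma eq_linear_ext k (f g : k.-tuple int -> k.-tuple V -> V) a :
  (forall d b, homogs G d b -> f d b = g d b) ->
  linear_ext G f a = linear_ext G g a.
Proof.
move=> fg; apply: eq_fsbigr => d _; apply: fg => i.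
by rewrite /homog tnth_mktuple gcomp_gcomp eqxx.
Qed.

Lemma multilinear0 k (f : k.-tuple V -> V) (a : k.-tuple V) i :
  multilinear f -> tnth a i = 0 -> f a = 0.
Proof.
move=> /(_ a i) lin ai0.
have /(_ (-1) 0 0) := lin; rewrite scaler0 addr0 scaleN1r addNr.
set b := [tuple _ | j < k] => fb0; suff -> : a = b by [].
by apply: eq_from_tnth => j; rewrite tnth_mktuple; case: eqP => [->|].
Qed.

(** Written as a permutation, the move can be composed with the permutations of the symmetrized
    sum. *)
Lemma move_lastE (T : Type) k (i : 'I_k.+1) (x : k.+1.-tuple T) :
  [tuple of rcons [tuple tnth x (lift i j) | j < k] (tnth x i)] =
  [tuple tnth x (lift_perm ord_max i 1 j) | j < k.+1].
Proof.
apply: eq_from_tnth => j; rewrite tnth_mktuple (tnth_nth (tnth x i)) /= nth_rcons.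
rewrite size_map -cardE card_ord; case: (unliftP ord_max j) => [p|] ->.
  rewrite lift_max ltn_ord lift_perm_lift perm1.
  have -> : forall y, nth y [seq tnth x (lift i j) | j <- enum 'I_k] p =
      tnth [tuple tnth x (lift i j) | j < k] p by move=> y; rewrite (tnth_nth y).
  by rewrite tnth_mktuple.
by rewrite /= ltnn eqxx lift_perm_id.
Qed.

(** In [linear_ext] every summand of degrees other than [d] has a zero entry, so multilinearity
    kills it. *)
Lemma preLie_of_homog (mu : colored_ops V) k d (a : k.+1.-tuple V) :
  (forall r, multilinear (mu k r)) ->
  homogs G d a ->
  preLie_of G mu a = \sum_(s : 'S_k.+1)
    koszul_sign K s d *: mu k (s^-1%g ord_max) (permute s a).
Proof.
move=> mulin; apply: (@linear_ext_homog K V G _ (fun d a => \sum_(s : 'S_k.+1)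
  koszul_sign K s d *: mu k (s^-1%g ord_max) (permute s a))).
move=> d' b i bi0; rewrite big1 // => s _.
rewrite (multilinear0 (i := s^-1%g i) (mulin _)) ?scaler0 //.
by rewrite tnth_mktuple permKV.
Qed.

End Symmetrization.

Theorem proposition7p10 (K : fieldType) (charK0 : [pchar K]%R =i pred0)
  (V : lmodType K) (G : grading V) (mu : Dend_infty G)
  (k : nat) (a : k.+1.-tuple V) :
  symmetrization G (color_sum mu) a = subadjacent G (preLie_of G mu) a.
Proof.
apply: eq_linear_ext => d {}a ha.
(* For fixed [s] the colour is renamed [s^-1 i], so that [i] is the input at the coloured
   position. *)
transitivity (\sum_(i < k.+1) \sum_(s : 'S_k.+1)
    koszul_sign K s d *: dend_mu mu (s^-1%g i) (permute s a)).
  rewrite exchange_big; apply: eq_bigr => s _ /=.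
  by rewrite -scaler_sumr /color_sum (reindex_inj (@perm_inj _ s^-1%g)).
apply: eq_bigr => i _; rewrite -koszul_sign_move_last.
pose c : 'S_k.+1 := lift_perm ord_max i 1.
have -> : move_last i a = permute c a by exact: move_lastE.
rewrite (preLie_of_homog (d := [tuple tnth d (c j) | j < k.+1])); first last.
  by move=> j; rewrite !tnth_mktuple; exact: ha.
  by move=> r; exact: dend_multilinear.
(* After substituting [s * c] for [s], the colour [(s * c)^-1 i] is [s^-1 ord_max], because [c]
   sends [ord_max] to [i]. *)
rewrite scaler_sumr (reindex_inj (mulIg c)) /=; apply: eq_bigr => s _.
rewrite koszul_signM scalerA mulrC; congr (_ *: _).
have -> : permute (s * c)%g a = permute s (permute c a).
  by apply: eq_from_tnth => j; rewrite !tnth_mktuple permM.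
by congr (dend_mu _ _ _); rewrite invMg permM -[i in LHS](lift_perm_id ord_max i 1) permK.
Qed.
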